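(* For every integer $r\ge2$, there exists a natural number $n_r \ge r-1$ such that for any natural number $n\ge n_r$ and any surjective $k$-colouring $\Delta:\mathbb{N}^{(r)}\to[k]$ with $k>\binom{n}{r}+1$, \[\mathcal{F}_\Delta\cap I_{r,n}\neq\emptyset,\qquad\text{where } I_{r,n}=\left(\binom{n}{r}+1,\ \binom{n+1}{r}+1\right].\]
   Context: Natural numbers are positive integers, $\mathbb{N}=\{1,2,\dots\}$, and $[k]=\{1,\dots,k\}$. For a set $X$, $X^{(r)}$ denotes the family of all subsets of $X$ of cardinality $r$ (the edges of the complete $r$-uniform hypergraph on $X$). For $X\subset\mathbb{N}$, let $\gamma_\Delta(X)=|\Delta(X^{(r)})|$ be the number of colours appearing on $r$-subsets of $X$. Define $\mathcal{F}_\Delta=\{\gamma_\Delta(X): X\subset\mathbb{N},\ X \text{ infinite}\}$. *)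

(* Defs.v *)
From mathcomp Require Import all_boot all_order finmap.
From mathcomp Require Import all_classical.

Set Implicit Arguments.
Unset Strict Implicit.
Unset Printing Implicit Defensive.

Local Open Scope classical_set_scope.
Local Open Scope nat_scope.

(** The natural numbers of the paper start at 1. *)
Definition Npos : set nat := [set x | 0 < x].

Definition rsubsets (X : set nat) (r : nat) : set {fset nat} :=
  [set e | [set` e] `<=` X /\ #|` e| = r].

(** The palette [k] is rendered as 'I_k. A colouring is a total function on
    {fset nat}; only its values on [rsubsets Npos r] are ever used. *)
Definition surjective_colouring (r k : nat) (Delta : {fset nat} -> 'I_k) : Prop :=
  set_surj (rsubsets Npos r) [set: 'I_k] Delta.

(** [fset_set A] is the finite set with the same elements as [A] when [A] is
    finite, which always holds here since 'I_k is a finite type. *)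
Definition gamma (r k : nat) (Delta : {fset nat} -> 'I_k) (X : set nat) : nat :=
  #|` fset_set (Delta @` rsubsets X r)|.

Definition calF (r k : nat) (Delta : {fset nat} -> 'I_k) : set nat :=
  [set gamma r Delta X | X in [set X | X `<=` Npos /\ infinite_set X]].

Definition interval_I (r n : nat) : set nat :=
  [set m | 'C(n, r) + 1 < m <= 'C(n + 1, r) + 1].

(* Main.v *)
Require Import Defs.
From mathcomp Require Import all_boot all_order finmap zify.
From mathcomp Require Import all_classical.

(** Choose a finite set [A] of positive integers whose [r]-subsets already show
    every colour. Ramsey's theorem, applied once for each [e] contained in [A],
    gives an infinite set [M] disjoint from [A] such that the colour of an
    [r]-set meeting [A] in [e], with all its other points in [M], depends on [e]
    alone; call it [c e] ([canonical_extension]). Hence, for every [B] contained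
    in [A], the number of colours on the infinite set formed by [B] and [M] is
    the number of values of [c] on the subsets of [B] of size at most [r]
    ([gamma_extension]), and the problem becomes finite.

    Let [B] be minimal such that the number [K] of these values exceeds
    [N = 'C(n, r) + 1] ([minimal_palette]). The claim is that
    [K <= 'C(n + 1, r) + 1]. By minimality, deleting any point [v] of [B]
    destroys at least [K - N] colours. Pick for each colour one subset of [B]
    that has it; a colour destroyed by deleting [v] must have [v] in its chosen
    subset. Counting incidences between points and chosen subsets gives
    [#|B| * (K - N) <= sum of the sizes of the chosen subsets].
    One colour, that of the empty set, contributes [0]; the others contribute at
    most [r], and at most ['C(#|B|, r)] of them contribute exactly [r]. This is
    [private_colours_count].

    The contradiction with [K > 'C(n + 1, r) + 1] is then arithmetic
    ([palette_size_bound]), because of the identity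
    [(n + 1) * 'C(n, r) = (n + 1 - r) * 'C(n + 1, r)]: it is exactly tight for
    [#|B| = n + 1] with all contributions bounded by [r], and for [#|B| = n] once
    one uses that only ['C(n, r)] contributions can equal [r]. Smaller sets [B]
    do not have enough subsets of size at most [r] to carry so many colours once
    [n >= 3 * r], since then the lower binomial coefficients are negligible. *)

Local Open Scope classical_set_scope.
Local Open Scope nat_scope.

(** * Ramsey's theorem for infinite sets of natural numbers *)

Lemma infinite_pigeonhole (C : finType) (c : nat -> C) :
  exists x, infinite_set [set i | c i = x].
Proof.
apply: contrapT => /forallNP fin; apply: infinite_nat.
have -> : [set: nat] = \bigcup_(x in [set: C]) [set i | c i = x].
  by apply/seteqP; split=> i // _; exists (c i).
apply: bigcup_finite; first exact: finite_finset.
by move=> x _; have /contrapT := fin x.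
Qed.

(** Induction on [r]. Starting from [X], repeatedly remove a point [x i] from
    the current infinite set [Y i] and pass to an infinite set [Y i.+1] of larger
    points on which the colour of an [r.+1]-set with least element [x i] is
    constantly [c i]. The colour of an [r.+1]-set of points [x i] is then the
    colour attached to its least element, and the pigeonhole principle makes the
    attached colours equal. *)
Lemma infinite_ramsey (C : finType) (r : nat) (D : {fset nat} -> C) (X : set nat) :
  infinite_set X ->
  exists2 M : set nat, M `<=` X /\ infinite_set M &
    exists x, forall e, rsubsets M r e -> D e = x.
Proof.
elim: r D X => [|r IH] D X infX.
  by exists X; [split | exists (D fset0) => e [_ /cardfs0_eq ->]].
have step (Y : set nat) : exists t : (nat * C) * set nat, infinite_set Y ->
    [/\ Y t.1.1, infinite_set t.2, t.2 `<=` Y `&` [set y | t.1.1 < y] &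
     forall f, rsubsets t.2 r f -> D (t.1.1 |` f)%fset = t.1.2].
  (* For finite [Y] any value will do: the iteration below stays among infinite sets. *)
  have [infY|finY] := pselect (infinite_set Y); last first.
    by exists (0, D fset0, set0) => /finY.
  have [x Yx] := infinite_setN0 infY.
  have [Z [ZY infZ] [d Zd]] := IH (fun f => D (x |` f)%fset) _
    (infinite_setD infY (finite_II x.+1)).
  exists (x, d, Z) => _; split=> // y /ZY [Yy] /= /negP.
  by rewrite -leqNgt.
have [F FP] := choice step.
pose Y := fix Y i := if i is j.+1 then (F (Y j)).2 else X.
pose x i := (F (Y i)).1.1; pose c i := (F (Y i)).1.2.
have infY i : infinite_set (Y i).
  by elim: i => //= i /FP[].
have Yx i : Y i (x i) by have [] := FP _ (infY i).
have YS i y : Y i.+1 y -> Y i y /\ x i < y.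
  by have [_ _ sub _] := FP _ (infY i); apply: sub.
have Yle i j : i <= j -> Y j `<=` Y i.
  elim: j => [|j IHj]; first by rewrite leqn0 => /eqP ->.
  rewrite leq_eqVlt => /predU1P[-> //|/IHj sub] y /YS[Yy _]; exact: sub.
have xlt i j : i < j -> x i < x j.
  by move=> ij; have /YS[] := Yle _ _ ij _ (Yx j).
have xinj : injective x.
  move=> i j xij; apply/eqP; case: ltngtP (xlt i j) (xlt j i) => // _.
    by move/(_ isT); rewrite xij ltnn.
  by move=> _ /(_ isT); rewrite xij ltnn.
have [d infI] := infinite_pigeonhole _ c.
exists (x @` [set i | c i = d]); last exists d.
  split; first by move=> _ [i _ <-]; apply: (Yle 0 i) => //; exact: Yx.
  move=> fin; apply: infI; have := finite_preimage (in2W xinj) fin.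
  by apply: sub_finite_set => i /= ci; exists i.
move=> e [eM ecard].
(* Split [e] as its least element [x i] and the rest, which lies in [Y i.+1]. *)
have ex : exists i, (c i == d) && (x i \in e).
  have : e != fset0 by rewrite -cardfs_eq0 ecard.
  by move=> /fset0Pn [y ye]; have [i ci xi] := eM _ ye; exists i; rewrite ci xi eqxx.
case: (ex_minnP ex) => i /andP[/eqP ci xie] imin.
have [_ _ _ key] := FP _ (infY i).
rewrite -(fsetD1K xie) -ci; apply: key; split.
  move=> y /=; rewrite !inE => /andP[yx ye]; have [j cj xj] := eM _ ye.
  rewrite -xj; apply: (Yle i.+1) (Yx j).
  rewrite ltn_neqAle imin ?andbT; last by rewrite cj eqxx xj.
  by apply: contra yx => /eqP ->; rewrite xj.
by have := cardfsD1 (x i) e; rewrite xie ecard => -[].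
Qed.

(** One application of Ramsey's theorem for each [e] in [s], to the colouring of
    the sets that complete [e] to size [r]; constancy survives the later
    shrinkings. When [e] has [r] elements the only completion is empty, so that
    [c e = D e]; when it has more, the truncated difference is again [0], which
    is harmless. *)
Lemma canonical_extension (C : finType) (r : nat) (D : {fset nat} -> C)
    (s : seq {fset nat}) (X : set nat) :
  infinite_set X ->
  exists2 M : set nat, M `<=` X /\ infinite_set M &
    exists c : {fset nat} -> C, forall e f, e \in s ->
      rsubsets M (r - #|` e|) f -> D (e `|` f)%fset = c e.
Proof.
elim: s X => [|e s IH] X infX; first by exists X; [split | exists D].
have [Y [YX infY] [x Yx]] :=
  infinite_ramsey _ (r - #|` e|) (fun f => D (e `|` f)%fset) _ infX.
have [M [MY infM] [c Mc]] := IH Y infY.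
exists M; first by split=> // y /MY /YX.
exists (fun e' => if e' == e then x else c e') => e' f; rewrite inE.
case: eqP => [-> _ [fM fcard]|_ /= e's]; last exact: Mc.
by apply: Yx; split=> // y /fM /MY.
Qed.

(** * Colours carried by the small subsets of a finite set *)

Lemma size_layer_le (T : choiceType) (B : {fset T}) j :
  size [seq e <- fpowerset B | #|` e| == j] <= 'C(#|` B|, j).
Proof.
rewrite cardfE -card_draws cardE.
rewrite -(size_map (fun Y : {set B} => [fsetval y in Y]%fset)).
apply: uniq_leq_size; first exact/filter_uniq/fset_uniq.
move=> e; rewrite mem_filter fpowersetE => /andP[/eqP ecard eB].
apply/mapP; exists (fsub B e); first by rewrite mem_enum inE card_fsub // ecard.
apply/fsetP => x; apply/idP/idP => [xe|].
  apply/imfsetP; exists [` fsubsetP eB _ xe]%fset => //=.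
  by rewrite inE.
by case/imfsetP => y /=; rewrite in_fsub => ye ->.
Qed.

(** When [c] is the canonical colouring, a set [e] of size less than [r] stands
    for all [r]-sets that consist of [e] and points of the infinite set. *)
Definition palette {T : choiceType} {C : finType} (r : nat)
    (c : {fset T} -> C) (B : {fset T}) : {set C} :=
  [set x in [seq c e | e <- fpowerset B & #|` e| <= r]].

Section Palette.
Variables (T : choiceType) (C : finType) (r : nat) (c : {fset T} -> C).
Implicit Types B e : {fset T}.

Lemma paletteP B (x : C) :
  reflect (exists e, [/\ (e `<=` B)%fset, #|` e| <= r & c e = x])
          (x \in palette r c B).
Proof.
rewrite inE; apply: (iffP mapP) => [[e]|[e [eB er <-]]].
  by rewrite mem_filter fpowersetE => /andP[er eB] ->; exists e.
by exists e; rewrite // mem_filter er fpowersetE.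
Qed.

Lemma card_palette_le B : #|palette r c B| <= \sum_(i < r.+1) 'C(#|` B|, i).
Proof.
rewrite cardsE; apply: leq_trans (card_size _) _; rewrite size_map.
elim: r => [|m IH]; rewrite big_ord_recr /=.
  rewrite big_ord0 add0n; apply: leq_trans (size_layer_le _ B 0).
  by under eq_filter do rewrite leqn0.
apply: leq_trans (leq_add IH (size_layer_le _ B m.+1)).
rewrite !size_filter -leq_subLR.
rewrite leq_subLR; elim: (enum_fset _) => //= e s IHs; lia.
Qed.

(** Let [f x] be a chosen set of colour [x]. If the colour [x] disappears when [v]
    is deleted, then every set of colour [x], in particular [f x], contains [v];
    so [v] has at least [K - N] colours [x] with [v \in f x]. Summing over [v]
    bounds [#|B| * (K - N)] by the sum of the sizes of the sets [f x]. The choice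
    [f (c fset0) = fset0] saves one term, and since [f] is injective at most
    ['C(#|B|, r)] of these sets have the full size [r]. *)
Lemma private_colours_count B N :
  0 < r -> (forall v, v \in B -> #|palette r c (B `\ v)%fset| <= N) ->
  #|` B| * #|palette r c B| <= #|` B| * N + r.-1 * #|palette r c B|.-1
                               + minn #|palette r c B|.-1 'C(#|` B|, r).
Proof.
move=> r0 NB; set K := #|palette r c B|.
have ex (x : C) : exists e : {fset T}, x \in palette r c B ->
    [/\ (e `<=` B)%fset, #|` e| <= r, c e = x & x = c fset0 -> e = fset0].
  case: (boolP (x \in palette r c B)); last by exists fset0.
  have [-> _|x0] := eqVneq x (c fset0).
    by exists fset0; split; rewrite ?fsub0set ?cardfs0.
  case/paletteP => e [eB er ce]; exists e; split=> // xx0.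
  by rewrite xx0 eqxx in x0.
have [f fP] := choice ex.
pose x0 := c fset0.
have x0P : x0 \in palette r c B.
  by apply/paletteP; exists fset0; rewrite fsub0set cardfs0.
have fx0 : f x0 = fset0 by have [_ _ _] := fP _ x0P; apply.
have Kx0 : K.-1 = #|palette r c B :\ x0| by rewrite /K (cardsD1 x0) x0P.
have loss v : v \in B -> K <= N + \sum_(x in palette r c B) (v \in f x).
  move=> vB; rewrite /K -(cardsID (palette r c (B `\ v)%fset)).
  apply: leq_add.
    by apply: leq_trans (NB v vB); apply/subset_leq_card/subsetIr.
  rewrite -sum1_card big_mkcond [leqRHS]big_mkcond; apply: leq_sum => x _.
  rewrite finset.in_setD; case: (boolP (x \in palette r c B)) => [xB|_]; rewrite ?andbF //.
  case: (boolP (v \in f x)) => [_|vf]; first by case: ifP.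
  have [fB fr cf _] := fP _ xB.
  suff -> : x \in palette r c (B `\ v)%fset by [].
  apply/paletteP; exists (f x); split=> //.
  by rewrite fsubsetD1 fB.
have sumf x : x \in palette r c B -> \sum_(v <- B) (v \in f x) <= #|` f x|.
  move=> xB; have [fB _ _ _] := fP _ xB.
  under eq_bigr => v _ do rewrite -[nat_of_bool _]/(if v \in f x then 1 else 0).
  rewrite -big_mkcond sum1_count -size_filter; apply: uniq_leq_size.
    exact/filter_uniq/fset_uniq.
  by move=> v; rewrite mem_filter => /andP[].
have : #|` B| * K <= #|` B| * N + \sum_(x in palette r c B) #|` f x|.
  rewrite card_fset_sum1 !big_distrl /=.
  apply: leq_trans (_ : \sum_(v <- B) (N + \sum_(x in palette r c B) (v \in f x)) <= _).
    rewrite big_seq [leqRHS]big_seq; apply: leq_sum => v vB; rewrite mul1n; exact: loss.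
  rewrite big_split /= exchange_big /=; apply: leq_add.
    by under [leqRHS]eq_bigr do rewrite mul1n.
  exact: leq_sum.
move/leq_trans; apply; rewrite -addnA leq_add2l (bigD1 x0) //= fx0 cardfs0 add0n.
(* [top] consists of the colours whose chosen set has the maximal size [r]. *)
pose top := [set x in palette r c B :\ x0 | #|` f x| == r].
have topP x : x \in top -> x \in palette r c B /\ #|` f x| = r.
  by rewrite finset.in_set finset.in_setD1 => /andP[/andP[_ ?] /eqP].
have topK : #|top| <= K.-1.
  by rewrite Kx0; apply/subset_leq_card/fintype.subsetP => x; rewrite finset.in_set => /andP[].
have topC : #|top| <= 'C(#|` B|, r).
  apply: leq_trans (size_layer_le _ B r); rewrite cardE -(size_map f).
  apply: uniq_leq_size.
    rewrite map_inj_in_uniq ?enum_uniq // => x y; rewrite !mem_enum.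
    move=> /topP[/fP[_ _ cx _] _] /topP[/fP[_ _ cy _] _] fxy.
    by rewrite -cx -cy fxy.
  move=> e /mapP[x]; rewrite mem_enum => /topP[/fP[fB _ _ _] /eqP fr] ->.
  by rewrite mem_filter fr fpowersetE.
apply: leq_trans (_ : r.-1 * K.-1 + #|top| <= _); last first.
  by rewrite leq_add2l leq_min topK.
rewrite Kx0 mulnC -sum_nat_const -sum1_card.
rewrite [X in _ <= _ + X]big_mkcond [X in _ <= X + _]big_mkcond [leqLHS]big_mkcond.
rewrite -big_split /=.
apply: leq_sum => x _.
rewrite [x \in top]finset.in_set finset.in_setD1 andbC.
case: (boolP (_ && _)) => //= /andP[_ xB].
have [_ fr _ _] := fP _ xB.
case: eqP => /= fxr; lia.
Qed.
End Palette.

Lemma minimal_palette (T : choiceType) (C : finType) r (c : {fset T} -> C) A N :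
  N < #|palette r c A| ->
  exists2 B, (B `<=` A)%fset & N < #|palette r c B| /\
    forall v, v \in B -> #|palette r c (B `\ v)%fset| <= N.
Proof.
have [m] := ubnP #|` A|; elim: m A => // m IH A Am NA.
have [[v vA Nv]|min] := pselect (exists2 v, v \in A & N < #|palette r c (A `\ v)%fset|).
  have [|B BA ?] := IH (A `\ v)%fset _ Nv.
    by move: Am; rewrite (cardfsD1 v) vA.
  by exists B => //; apply: fsubset_trans BA (fsubD1set _ _).
exists A => //; split=> // v vA; rewrite leqNgt; apply/negP => Nv.
by apply: min; exists v.
Qed.

(** * Arithmetic of the window *)

(** As long as [3 * s <= m.+1], consecutive binomial coefficients ['C(m, i)] up to
    [i = s] at least double, so that they are dominated by a geometric series. *)
Lemma sum_bin_le m s : 3 * s <= m.+1 -> \sum_(i < s) 'C(m, i) <= 'C(m, s).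
Proof.
elim: s => [|s IH] sm; first by rewrite big_ord0.
rewrite big_ord_recr /=; have {}IH : \sum_(i < s) 'C(m, i) <= 'C(m, s) by apply: IH; lia.
have : s.+1 * (2 * 'C(m, s)) <= s.+1 * 'C(m, s.+1).
  by rewrite mul_bin_left mulnA leq_mul2r; apply/orP; right; lia.
by rewrite leq_pmul2l //; apply: leq_trans; rewrite mul2n -addnn leq_add2r.
Qed.

(** Write [L = K - 1] and suppose that [L > 'C(n.+1, r)]. If [a = n], bounding the
    minimum by ['C(n, r)] gives [(n.+1 - r) * L <= n.+1 * 'C(n, r)], whose right
    side is [(n.+1 - r) * 'C(n.+1, r)]. If [a > n], bounding the minimum by [L]
    gives [(a - r) * L <= a * 'C(n, r)], contradicted by the same identity for
    [a = n.+1] and, for each further point, by [L > 'C(n, r)]. If [a < n], the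
    sum of binomials is too small, since by Pascal's rule ['C(n.+1, r)] is
    ['C(n.-1, r) + 2 * 'C(n.-1, r.-1) + 'C(n.-1, r.-2)]. *)
Lemma palette_size_bound r n a K : 2 <= r -> 3 * r <= n ->
  K <= \sum_(i < r.+1) 'C(a, i) ->
  a * K <= a * ('C(n, r) + 1) + r.-1 * K.-1 + minn K.-1 'C(a, r) ->
  K <= 'C(n + 1, r) + 1.
Proof.
move=> r2 rn Kle cnt; rewrite leqNgt; apply/negP => Kgt.
have down := mul_bin_down n.+1 r; rewrite /= in down.
have PQ : 'C(n, r) <= 'C(n.+1, r) by apply: leq_bin2l.
rewrite !addn1 in Kgt.
case: K Kle cnt Kgt => [|L] //= Kle cnt Kgt.
have LQ : 'C(n.+1, r) < L by lia.
have minL := geq_minl L 'C(a, r); have minC := geq_minr L 'C(a, r).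
case: (ltngtP a n) => [an|an|an]; last 1 first.
- rewrite an in cnt minC.
  have : (n.+1 - r) * L <= n.+1 * 'C(n, r).
    rewrite mulnBl leq_subLR.
    by move: 'C(n, r) (minn L _) cnt minC {minL down PQ} => P m cnt minC; nia.
  rewrite down leq_pmul2l; lia.
- have : L.+1 <= 'C(n.+1, r); last by lia.
  have {}an : a <= n.-1 by lia.
  case: r r2 {Kgt LQ minL minC PQ down cnt} rn Kle => [|[|r]] // _ rn Kle.
  case: n rn an => // n rn an; rewrite /= in an.
  have : \sum_(i < r.+3) 'C(a, i) <= \sum_(i < r.+3) 'C(n, i).
    by apply: leq_sum => i _; apply: leq_bin2l.
  rewrite [X in _ <= X]big_ord_recr [X in _ <= X + _]big_ord_recr /=.
  have : \sum_(i < r.+1) 'C(n, i) <= 'C(n, r.+1) by apply: sum_bin_le; lia.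
  rewrite !binS; move: (\sum_(i < r.+1) _) (\sum_(i < r.+3) _) Kle => S S' Kle; lia.
have [d ad] : exists d, a = n.+1 + d by exists (a - n.+1); lia.
rewrite ad in cnt.
have ineq : (n.+1 + d - r) * L <= (n.+1 + d) * 'C(n, r) by nia.
have : (n.+1 - r + d) * L <= (n.+1 - r) * 'C(n.+1, r) + d * 'C(n, r).
  by rewrite -down; nia.
rewrite mulnDl; apply/negP; rewrite -ltnNge -addSn leq_add //.
  by rewrite ltn_pmul2l; lia.
by rewrite leq_mul2l; lia.
Qed.

(** * From the infinite problem to the finite one *)

(** An [r]-set in the union of [B] and [M] splits into its parts in [B] and in
    [M], and its colour is determined by the first part. Conversely every subset
    of [B] with at most [r] elements can be completed inside [M], which is
    infinite. *)
Lemma gamma_extension r k (D : {fset nat} -> 'I_k) (c : {fset nat} -> 'I_k)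
    (M : set nat) (B : {fset nat}) :
  infinite_set M -> M `&` [set` B] = set0 ->
  (forall e f, (e `<=` B)%fset -> rsubsets M (r - #|` e|) f -> D (e `|` f)%fset = c e) ->
  gamma r D ([set` B] `|` M) = #|palette r c B|.
Proof.
move=> infM MB Dc.
suff -> : gamma r D ([set` B] `|` M) = #|` fset_set [set` [fset x in palette r c B]%fset]|.
  by rewrite set_fsetK card_finset.
congr (#|` fset_set _|); apply/seteqP; split=> x /=.
  move=> [e [eBM er] <-]; rewrite inE; apply/paletteP; exists (e `&` B)%fset; split.
  - exact: fsubsetIr.
  - by rewrite -er; apply/fsubset_leq_card/fsubsetIl.
  rewrite -(Dc _ (e `\` B)%fset) ?fsubsetIr ?fsetID //; split.
    by move=> y /=; rewrite !inE => /andP[/negP yB ye]; case: (eBM y ye).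
  by rewrite cardfsD er.
rewrite inE => /paletteP[e [eB er <-]].
have [F FM Fr] := infinite_set_fset (r - #|` e|) infM.
pose f := [fset x in take (r - #|` e|) F]%fset.
have fr : #|` f| = r - #|` e|.
  by rewrite card_fseq undup_id ?take_uniq ?fset_uniq // size_take_min; apply/minn_idPl.
have fM : [set` f] `<=` M by move=> y; rewrite /= inE => /mem_take /FM.
exists (e `|` f)%fset; last exact: Dc.
split.
  move=> y /=; rewrite inE => /orP[ye|yf]; first by left; apply: (fsubsetP eB).
  by right; apply: fM.
rewrite cardfsU fr; suff -> : (e `&` f = fset0)%fset by rewrite cardfs0; lia.
apply/fsetP => y; rewrite !inE /=; apply/negP => /andP[ye yf].
have : (M `&` [set` B]) y by split; [apply: fM; rewrite /= inE | apply: (fsubsetP eB)].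
by rewrite MB.
Qed.

Theorem theorem1p3 (r : nat) (hr : 2 <= r) :
  exists2 n_r : nat, r - 1 <= n_r &
    forall n : nat, n_r <= n ->
    forall (k : nat) (Delta : {fset nat} -> 'I_k),
      'C(n, r) + 1 < k ->
      surjective_colouring r Delta ->
      calF r Delta `&` interval_I r n !=set0.
Proof.
exists (3 * r); first lia.
move=> n rn k D kbig surj.
have [g gP] : exists g : 'I_k -> {fset nat}, forall x, rsubsets Npos r (g x) /\ D (g x) = x.
  suff /choice[g gP] : forall x, exists e, rsubsets Npos r e /\ D e = x by exists g.
  by move=> x; have [e eP <-] := surj x I; exists e.
pose A := [fset v in flatten [seq enum_fset (g x) | x <- enum 'I_k]]%fset.
have gA x : (g x `<=` A)%fset.
  apply/fsubsetP => v vg; rewrite inE; apply/flatten_mapP.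
  by exists x; rewrite ?mem_enum.
have AN : [set` A] `<=` Npos.
  move=> v; rewrite /= inE => /flatten_mapP[x _ vg].
  by have [[gN _] _] := gP x; apply: gN.
(* Removing [0] from the ground set keeps [M] inside [Npos]. *)
have infX : infinite_set (~` [set` (0 |` A)%fset]).
  by rewrite -setTD; apply: infinite_setD infinite_nat (finite_fset _).
have [M [MX infM] [c Dc]] := canonical_extension _ r D (fpowerset A) _ infX.
have MA (B : {fset nat}) : (B `<=` A)%fset -> M `&` [set` B] = set0.
  move=> /fsubsetP BA; apply/seteqP; split=> // v [/MX /= vA /BA vB].
  by apply: vA; rewrite in_fset1U vB orbT.
have ext (B : {fset nat}) : (B `<=` A)%fset -> gamma r D ([set` B] `|` M) = #|palette r c B|.
  move=> BA; apply: gamma_extension (MA B BA) _ => // e f eB; apply: Dc.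
  by rewrite fpowersetE (fsubset_trans eB).
(* The set [g x] has exactly [r] elements, hence [c (g x) = D (g x)]. *)
have palA : palette r c A = [set: 'I_k]%SET.
  apply/finset.setP => x; rewrite finset.in_setT; apply/paletteP.
  exists (g x); have [[_ gr] gx] := gP x.
  split=> //; first by rewrite gr.
  rewrite -{2}gx -[in RHS](fsetU0 (g x)) (Dc _ fset0) ?fpowersetE //.
  by rewrite gr subnn; split; rewrite ?cardfs0.
have [|B BA [Bgt Bmin]] := minimal_palette _ _ r c A ('C(n, r) + 1).
  by rewrite palA cardsT card_ord.
exists #|palette r c B|; split; last first.
  rewrite /interval_I /= Bgt /=.
  apply: (palette_size_bound _ _ _ _ hr rn (card_palette_le _ _ r c B)).
  apply: private_colours_count => //; exact: ltnW.
exists ([set` B] `|` M); last exact: ext.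
split; last by apply: sub_infinite_set infM => v; right.
move=> v [vB|/MX /= vM]; first by apply: AN; apply: (fsubsetP BA).
by rewrite /Npos /= lt0n; apply/eqP => v0; apply: vM; rewrite v0 in_fset1U eqxx.
Qed.
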